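(* Let $\mathcal{C}\subset\mathbb{R}^d$ be closed and nonempty, let $\|\cdot\|$ be any norm on $\mathbb{R}^d$ with dual norm $\|\cdot\|^*$, let $g:\mathbb{R}^d\to\mathbb{R}$ be differentiable, and let $\widehat{x}\in\arg\min_{x\in\mathcal{C}}g(x)$. Let $\rho>0$, $0<\alpha\le\beta$, $\varepsilon_g\ge 0$, $\phi\ge1$ and $c_0>0$, and suppose: (i) (norm compatibility) $\|z-P_{\mathcal{C}}(z)\|^*\le\phi\min_{x\in\mathcal{C}}\|z-x\|^*$ for all $z\in\mathbb{R}^d$; (ii) (restricted strong convexity and restricted smoothness) for all $x,y\in\mathcal{C}\cap\mathbb{B}_2(\widehat{x},\rho)$, $$g(y)\ge g(x)+\langle y-x,\nabla g(x)\rangle+\tfrac{\alpha}{2}\|x-y\|_2^2-\tfrac{\alpha}{2}\varepsilon_g^2,\qquad g(y)\le g(x)+\langle y-x,\nabla g(x)\rangle+\tfrac{\beta}{2}\|x-y\|_2^2+\tfrac{\alpha}{2}\varepsilon_g^2;$$ (iii) (initialization condition) $2\phi\cdot\max_{x,x'\in\mathcal{C}\cap\mathbb{B}_2(\widehat{x},\rho)}\gamma_x(\mathcal{C})\,\|\nabla g(x')\|^*\le(1-c_0)\cdot\alpha$, i.e. $2\phi\,\gamma_x(\mathcal{C})\|\nabla g(x')\|^*\le(1-c_0)\alpha$ for all $x,x'\in\mathcal{C}\cap\mathbb{B}_2(\widehat{x},\rho)$. Suppose the initial point $x_0\in\mathcal{C}$ and the error level satisfy $\|x_0-\widehat{x}\|_2^2<\rho^2$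 and $\varepsilon_g^2<\frac{c_0\rho^2}{1.5}$. Define the projected gradient descent iterates with step size $\eta=1/\beta$ by $x'_{t+1}=x_t-\eta\nabla g(x_t)$, $x_{t+1}=P_{\mathcal{C}}(x'_{t+1})$ for $t\ge0$ (if the projection is not unique, any closest point may be chosen). Then for every $t\ge0$, $$\|x_t-\widehat{x}\|_2^2\le\left(1-c_0\cdot\frac{2\alpha}{\alpha+\beta}\right)^t\|x_0-\widehat{x}\|_2^2+\frac{1.5\,\varepsilon_g^2}{c_0}.$$
   Context: $\|\cdot\|_2$ is the Euclidean norm, $\langle\cdot,\cdot\rangle$ the standard inner product, and $\mathbb{B}_2(u,\rho)$ the (closed) $\ell_2$ ball of radius $\rho$ around $u$. $P_{\mathcal{C}}(z)\in\arg\min_{x\in\mathcal{C}}\|x-z\|_2$; if the minimizer is non-unique, $P_{\mathcal{C}}(z)$ denotes any minimizer, any claim or assumption involving $P_{\mathcal{C}}(z)$ is to hold for every choice, and ''$P_{\mathcal{C}}(z)=x$'' means that $x$ is a minimizer. Degenerate points: $\mathcal{C}_{\mathrm{dgn}}=\{x\in\mathcal{C}:P_{\mathcal{C}}\text{ is not continuous over any neighborhood of }x\}$. Local concavity coefficients (with respect to $\|\cdot\|$): $\gamma_x(\mathcal{C})=\infty$ if $x\in\mathcal{C}_{\mathrm{dgn}}$, and for $x\in\mathcal{C}\setminus\mathcal{C}_{\mathrm{dgn}}$, $\gamma_x(\mathcal{C})$ is the smallest $\gamma\in[0,\infty]$ such that $\langle y-x,z-x\rangle\le\gamma\|z-x\|^*\|y-x\|_2^2$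 for all $y\in\mathcal{C}$ and all $z\in\mathbb{R}^d$ with $P_{\mathcal{C}}(z)=x$. Convention: $0\cdot\infty=0$. *)

(* Defs.v *)
(* MathComp-Analysis, over an arbitrary R : realType. *)
From HB Require Import structures.
From mathcomp Require Import all_boot all_order all_algebra.
From mathcomp Require Import all_classical all_reals all_analysis.

Set Implicit Arguments.
Unset Strict Implicit.
Unset Printing Implicit Defensive.

Import Order.TTheory GRing.Theory Num.Theory.
Import numFieldNormedType.Exports.

Local Open Scope classical_set_scope.
Local Open Scope ring_scope.

(* Vectors of R^d are row vectors 'rV[R]_d.  The library norm `|v| on them is
   the sup norm; it enters only through the topology (closedness, continuity,
   differentiability), which is the usual one of R^d. *)

Definition dotp (R : realType) (d : nat) (u v : 'rV[R]_d) : R :=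
  \sum_(i < d) u 0 i * v 0 i.

Definition l2norm (R : realType) (d : nat) (u : 'rV[R]_d) : R :=
  Num.sqrt (dotp u u).

Definition l2ball (R : realType) (d : nat) (u : 'rV[R]_d) (rho : R) :
    set 'rV[R]_d :=
  [set v | l2norm (v - u) <= rho].

(* Nonnegativity and N 0 = 0 follow from the three axioms. *)
Record is_norm (R : realType) (d : nat) (N : 'rV[R]_d -> R) : Prop := IsNorm {
  is_norm_triangle : forall u v, N (u + v) <= N u + N v ;
  is_norm_homogeneous : forall (a : R) u, N (a *: u) = `|a| * N u ;
  is_norm_definite : forall u, N u = 0 -> u = 0 }.

(* For a norm N on R^d the supremum is over a nonempty bounded set. *)
Definition dual_norm (R : realType) (d : nat) (N : 'rV[R]_d -> R)
    (z : 'rV[R]_d) : R :=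
  sup [set dotp z v | v in [set v | N v <= 1]].

Definition grad (R : realType) (d : nat) (g : 'rV[R]_d -> R) (x : 'rV[R]_d) :
    'rV[R]_d :=
  \row_(i < d) 'D_(delta_mx 0 i) g x.

Definition is_argmin (R : realType) (T : Type) (C : set T) (f : T -> R)
    (x : T) : Prop :=
  C x /\ forall y, C y -> f x <= f y.

(* "P_C(z) = p": the projection is treated as multivalued. *)
Definition is_proj (R : realType) (d : nat) (C : set 'rV[R]_d)
    (z p : 'rV[R]_d) : Prop :=
  is_argmin C (fun x => l2norm (x - z)) p.

(* Continuity of P_C is required of every single-valued choice of P_C. *)
Definition proj_continuous_on (R : realType) (d : nat) (C U : set 'rV[R]_d) :
    Prop :=
  forall P : 'rV[R]_d -> 'rV[R]_d,
    (forall z, is_proj C z (P z)) -> {within U, continuous P}.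

Definition degenerate (R : realType) (d : nat) (C : set 'rV[R]_d) :
    set 'rV[R]_d :=
  [set x | C x /\ forall U, nbhs x U -> ~ proj_continuous_on C U].

(* Products are taken in \bar R, where 0 * +oo = 0. *)
Definition concavity_bound (R : realType) (d : nat) (N : 'rV[R]_d -> R)
    (C : set 'rV[R]_d) (x : 'rV[R]_d) : set (\bar R) :=
  [set gamma | (0%:E <= gamma)%E /\
     forall y z, C y -> is_proj C z x ->
       ((dotp (y - x) (z - x))%:E <=
          gamma * (dual_norm N (z - x))%:E * (l2norm (y - x) ^+ 2)%:E)%E].

(* The admissible bounds form a closed subset of [0, +oo] containing +oo, so the
   infimum is the smallest one.  Only meaningful for x in C. *)
Definition local_concavity (R : realType) (d : nat) (N : 'rV[R]_d -> R)
    (C : set 'rV[R]_d) (x : 'rV[R]_d) : \bar R :=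
  if `[< degenerate C x >] then +oo%E else ereal_inf (concavity_bound N C x).

Definition pgd_iterates (R : realType) (d : nat) (C : set 'rV[R]_d)
    (g : 'rV[R]_d -> R) (eta : R) (x : nat -> 'rV[R]_d) : Prop :=
  forall t, is_proj C (x t - eta *: grad g (x t)) (x t.+1).

(* Main.v *)
Require Import Defs.
From HB Require Import structures.
From mathcomp Require Import all_boot all_order all_algebra.
From mathcomp Require Import ring lra.
From mathcomp Require Import all_classical all_reals all_analysis.

Import Order.TTheory GRing.Theory Num.Theory.
Import numFieldNormedType.Exports.

Local Open Scope classical_set_scope.
Local Open Scope ring_scope.

(* Compatibility of the norms turns the initialization condition into the
   one-sided bound <y - p, u - s v - p> <= s (1 - c0) alpha / 2 |y - p|^2, with
   v the gradient at u, for every projection p of u - s v lying in the ball.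
   This single bound is used three times:
   - with p a projection of xhat - s v and s -> 0, it gives the first-order
     condition at the minimiser xhat;
   - together with restricted convexity and smoothness it gives the contraction
     (1 - A + 2 c0 A) |p - xhat|^2 <= (1 - A) |u - xhat|^2 + 2 c0 A E, where
     A = s alpha and E = 1.5 eps_g^2 / c0, valid as soon as p is in the ball;
   - since it makes the projection along s |-> u - s v Lipschitz, it keeps p in
     the ball: moving s from 0 to 1 / beta by small substeps, the contraction
     puts each projection at a fixed distance inside the ball, and the next one
     cannot jump out.
   Degeneracy only enters through the value +oo of the concavity coefficient. *)

(** * Inner product and Euclidean norm on row vectors *)

Section Euclid.
Context {R : realType} {d : nat}.
Implicit Types (u v w : 'rV[R]_d) (a : R).

Lemma dotpC u v : dotp u v = dotp v u.
Proof. by rewrite /dotp; apply: eq_bigr => i _; rewrite mulrC. Qed.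

Lemma dotpDl u v w : dotp (u + v) w = dotp u w + dotp v w.
Proof.
by rewrite /dotp -big_split /=; apply: eq_bigr => i _; rewrite mxE mulrDl.
Qed.

Lemma dotpZl a u v : dotp (a *: u) v = a * dotp u v.
Proof.
by rewrite /dotp big_distrr /=; apply: eq_bigr => i _; rewrite mxE mulrA.
Qed.

Lemma dotpNl u v : dotp (- u) v = - dotp u v.
Proof. by rewrite -scaleN1r dotpZl mulN1r. Qed.

Lemma dotpDr u v w : dotp w (u + v) = dotp w u + dotp w v.
Proof. by rewrite dotpC dotpDl !(dotpC w). Qed.

Lemma dotpZr a u v : dotp u (a *: v) = a * dotp u v.
Proof. by rewrite dotpC dotpZl dotpC. Qed.

Lemma dotpNr u v : dotp u (- v) = - dotp u v.
Proof. by rewrite dotpC dotpNl dotpC. Qed.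

Lemma dotp0r u : dotp u 0 = 0.
Proof. by rewrite -(scale0r 0) dotpZr mul0r. Qed.

Definition dotpE := (dotpDl, dotpDr, dotpNl, dotpNr, dotpZl, dotpZr).

Lemma dotp_ge0 u : 0 <= dotp u u.
Proof. by rewrite /dotp sumr_ge0// => i _; rewrite -expr2 sqr_ge0. Qed.

Lemma l2norm_ge0 u : 0 <= l2norm u.
Proof. exact: sqrtr_ge0. Qed.

Lemma l2norm_sqr u : l2norm u ^+ 2 = dotp u u.
Proof. by rewrite /l2norm sqr_sqrtr ?dotp_ge0. Qed.

Lemma l2normN u : l2norm (- u) = l2norm u.
Proof. by rewrite /l2norm dotpNl dotpNr opprK. Qed.

Lemma l2normZ a u : 0 <= a -> l2norm (a *: u) = a * l2norm u.
Proof.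
move=> a0; apply/eqP; rewrite -(@eqrXn2 _ 2)// ?mulr_ge0 ?l2norm_ge0//.
by rewrite exprMn !l2norm_sqr dotpZl dotpZr mulrA expr2.
Qed.

Lemma dotp_eq0 u : dotp u u = 0 -> u = 0.
Proof.
move=> /eqP; rewrite psumr_eq0 => [/allP h|i _]; last by rewrite -expr2 sqr_ge0.
apply/rowP => i; rewrite mxE; apply/eqP.
by have := h i (mem_index_enum _); rewrite mulf_eq0 orbb.
Qed.

Lemma l2norm_eq0 u : l2norm u = 0 -> u = 0.
Proof. by move=> u0; apply: dotp_eq0; rewrite -l2norm_sqr u0 expr0n. Qed.

(** Cauchy-Schwarz, from the nonnegative square of [l2norm v *: u - l2norm u *: v], divided by
    [l2norm u * l2norm v]. *)
Lemma dotp_le_l2norm u v : dotp u v <= l2norm u * l2norm v.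
Proof.
have [u0|u0] := eqVneq (l2norm u) 0.
  by rewrite u0 (l2norm_eq0 _ u0) mul0r dotpC dotp0r.
have [v0|v0] := eqVneq (l2norm v) 0.
  by rewrite v0 (l2norm_eq0 _ v0) mulr0 dotp0r.
have uv0 : 0 < l2norm u * l2norm v.
  by rewrite mulr_gt0// lt_def ?u0 ?v0 l2norm_ge0.
rewrite -subr_ge0 -(pmulr_rge0 _ uv0).
have := dotp_ge0 (l2norm v *: u - l2norm u *: v).
rewrite !dotpE -!l2norm_sqr (dotpC v u); nra.
Qed.

Lemma l2normD u v : l2norm (u + v) <= l2norm u + l2norm v.
Proof.
rewrite -ler_sqr ?nnegrE ?addr_ge0 ?l2norm_ge0//.
have := dotp_le_l2norm u v.
rewrite sqrrD !l2norm_sqr !dotpE (dotpC v u); lra.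
Qed.

Lemma normr_le_l2norm u : `|u| <= l2norm u.
Proof.
rewrite [`|u|]mx_normrE; apply/bigmax_leP; split=> [|[i j] _ /=].
  exact: l2norm_ge0.
rewrite -ler_sqr ?nnegrE ?l2norm_ge0// l2norm_sqr real_normK ?num_real//.
rewrite ord1 /dotp (bigD1 j)//= -expr2 lerDl sumr_ge0// => k _.
by rewrite -expr2 sqr_ge0.
Qed.

Lemma is_norm_l2norm : is_norm (@l2norm R d).
Proof.
split; [exact: l2normD| |exact: l2norm_eq0] => a u.
by rewrite /l2norm dotpZl dotpZr mulrA -expr2 sqrtrM ?sqr_ge0// sqrtr_sqr.
Qed.

End Euclid.

(** * Equivalence of an arbitrary norm with the sup norm *)

Section Norms.
Context {R : realType} {d : nat} (N : 'rV[R]_d -> R) (N_norm : is_norm N).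
Implicit Types (u v w z : 'rV[R]_d) (a : R).

Lemma is_norm0 : N 0 = 0.
Proof. by rewrite -(scale0r 0) (is_norm_homogeneous N_norm) normr0 mul0r. Qed.

Lemma is_normN u : N (- u) = N u.
Proof.
by rewrite -scaleN1r (is_norm_homogeneous N_norm) normrN normr1 mul1r.
Qed.

Lemma is_norm_ge0 u : 0 <= N u.
Proof.
have := is_norm_triangle N_norm u (- u); rewrite subrr is_norm0 is_normN; lra.
Qed.

Lemma is_norm_le_sup_norm : exists2 K, 0 <= K & forall u, N u <= K * `|u|.
Proof.
exists (\sum_(i < d) N (delta_mx 0 i)).
  by apply: sumr_ge0 => i _; exact: is_norm_ge0.
move=> u; rewrite {1}[u]row_sum_delta mulr_suml.
apply: (@le_trans _ _ (\sum_(i < d) N (u 0 i *: delta_mx 0 i))).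
  elim/big_ind2 : _ => //; first by rewrite is_norm0.
  move=> v1 a1 v2 a2 h1 h2.
  by apply: le_trans (is_norm_triangle N_norm _ _) _; exact: lerD.
apply: ler_sum => i _; rewrite (is_norm_homogeneous N_norm) mulrC.
rewrite ler_wpM2l ?is_norm_ge0// [`|u|]mx_normrE.
exact: (le_bigmax _ (fun ij : 'I_1 * 'I_d => `|u ij.1 ij.2|) (0, i)).
Qed.

Lemma is_norm_dist u v : `|N u - N v| <= N (u - v).
Proof.
have := is_norm_triangle N_norm (u - v) v.
have := is_norm_triangle N_norm (v - u) u.
rewrite !subrK -(is_normN (v - u)) opprB ler_norml; lra.
Qed.

Lemma continuous_is_norm z : continuous (fun u => N (u - z)).
Proof.
have [K K0 NK] := is_norm_le_sup_norm.
move=> u; apply/(@cvgrPdist_le _ _ _ (nbhs u)) => e e0.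
have K1 : 0 < K + 1 by lra.
apply/(@nbhs_normP R 'rV[R]_d u); exists (e / (K + 1)); first exact: divr_gt0.
move=> v /ltW; rewrite /= ler_pdivlMr// => uv.
apply: le_trans (is_norm_dist _ _) _; rewrite opprB addrA subrK.
apply: le_trans (NK _) (le_trans _ uv).
by rewrite mulrC ler_wpM2l// lerDl.
Qed.

(** The constant is the minimum of [N] on the compact sup-norm unit sphere, positive by
    definiteness. *)
Lemma sup_norm_le_is_norm : exists2 k, 0 < k & forall u, k * `|u| <= N u.
Proof.
pose S : set 'rV[R]_d := [set u | `|u| = 1].
(* The sphere is empty exactly when [d = 0]; then any positive constant works. *)
have [S0|/set0P/negP/negPn/eqP S0] := pselect (S !=set0); last first.
  exists 1 => // u; have [->|u0] := eqVneq u 0.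
    by rewrite normr0 mulr0 is_norm0.
  suff : S (`|u|^-1 *: u) by rewrite S0.
  by rewrite /S/= normrZ normfV normr_id mulVf// normr_eq0.
have Sc : compact S.
  apply: bounded_closed_compact.
    by exists 1; split; [exact: num_real|move=> M /ltW hM u /= ->].
  apply: (@preimage_closed _ _ (fun u : 'rV[R]_d => `|u|) [set a | a = 1]).
    by move=> u _; exact: norm_continuous.
  exact: closed_eq.
have [p] := @EVT_min_rV _ _ (fun u => N (u - 0)) _ S0 Sc
  (continuous_subspaceT (continuous_is_norm 0)).
rewrite inE subr0 => Sp pmin; exists (N p).
  rewrite lt_def is_norm_ge0 andbT; apply/eqP => /(is_norm_definite N_norm) p0.
  by move: Sp; rewrite /S/= p0 normr0 => /esym/eqP; rewrite oner_eq0.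
move=> u; have [->|u0] := eqVneq u 0; first by rewrite normr0 mulr0 is_norm0.
have u0' : 0 < `|u| by rewrite normr_gt0.
have : N p <= N (`|u|^-1 *: u - 0).
  apply: pmin; rewrite inE /S/= normrZ normfV normr_id mulVf//.
  by rewrite normr_eq0.
rewrite subr0 (is_norm_homogeneous N_norm) normfV normr_id.
by rewrite mulrC ler_pdivlMr.
Qed.

End Norms.

(** * The dual norm *)

Section DualNorm.
Context {R : realType} {d : nat} (N : 'rV[R]_d -> R) (N_norm : is_norm N).
Implicit Types (u v z : 'rV[R]_d).

(** The unit ball of [N] is bounded by norm equivalence, so Cauchy-Schwarz applies. Without an upper
    bound [sup] would only return a default value. *)
Lemma has_ubound_dual z : has_ubound [set dotp z v | v in [set v | N v <= 1]].
Proof.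
have [k k0 kN] := sup_norm_le_is_norm _ N_norm.
have [K K0 l2K] := is_norm_le_sup_norm _ (@is_norm_l2norm R d).
exists (l2norm z * (K / k)) => _ [v /= v1 <-].
apply: le_trans (dotp_le_l2norm _ _) _; rewrite ler_wpM2l ?l2norm_ge0//.
apply: le_trans (l2K v) _; rewrite ler_wpM2l// -[k^-1]mul1r ler_pdivlMr//.
by rewrite mulrC (le_trans (kN v)).
Qed.

Lemma dotp_le_dual_norm z v : N v <= 1 -> dotp z v <= dual_norm N z.
Proof. by move=> v1; apply: (ub_le_sup (has_ubound_dual z)); exists v. Qed.

Lemma dual_norm_ge0 z : 0 <= dual_norm N z.
Proof.
apply: le_trans (dotp_le_dual_norm z 0 _); last by rewrite (is_norm0 _ N_norm).
by rewrite dotp0r.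
Qed.

Lemma dual_norm_gt0 z : z != 0 -> 0 < dual_norm N z.
Proof.
move=> z0.
have Nz : 0 < N z.
  rewrite lt_def (is_norm_ge0 _ N_norm) andbT; apply: contra z0 => /eqP.
  by move=> /(is_norm_definite N_norm) ->.
apply: lt_le_trans (dotp_le_dual_norm z ((N z)^-1 *: z) _).
  rewrite dotpZr mulr_gt0 ?invr_gt0// lt_def dotp_ge0 andbT.
  by apply: contra z0 => /eqP/dotp_eq0 ->.
by rewrite (is_norm_homogeneous N_norm) normfV gtr0_norm// mulVf ?gt_eqF.
Qed.

Lemma dual_normZN s z : 0 <= s -> dual_norm N (- (s *: z)) <= s * dual_norm N z.
Proof.
move=> s0; apply: ge_sup.
  by exists (dotp (- (s *: z)) 0), 0 => //=; rewrite (is_norm0 _ N_norm).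
move=> _ [v /= v1 <-]; rewrite dotpNl dotpZl -mulrN ler_wpM2l// -dotpNr.
by apply: dotp_le_dual_norm; rewrite (is_normN _ N_norm).
Qed.

End DualNorm.


(** * Projections onto a closed set and the concavity inequality *)

Lemma exists_proj {R : realType} {d : nat} (C : set 'rV[R]_d) (z : 'rV[R]_d) :
  closed C -> C !=set0 -> exists p, is_proj C z p.
Proof.
move=> Ccl [c Cc].
(* Points farther from [z] than [c] cannot be closest, so a compact piece of [C] suffices. *)
pose K := C `&` [set v | l2norm (v - z) <= l2norm (c - z)].
have Kc : compact K.
  apply: bounded_closed_compact; last first.
    apply: closedI => //.
    apply: (@preimage_closed 'rV[R]_d R (fun v => l2norm (v - z))
      [set a | a <= l2norm (c - z)]).
      by move=> v _; exact: (continuous_is_norm _ is_norm_l2norm).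
    exact: closed_le.
  exists (l2norm (c - z) + `|z|); split; first exact: num_real.
  move=> M /ltW hM v [_ /= hv]; apply: le_trans hM.
  rewrite -[v](subrK z); apply: le_trans (ler_normD _ _) _.
  by rewrite lerD2r; apply: le_trans hv; exact: normr_le_l2norm.
have [p] := @EVT_min_rV _ _ (fun v => l2norm (v - z)) _
  (ex_intro _ c (conj Cc (lexx _))) Kc
  (continuous_subspaceT (continuous_is_norm _ is_norm_l2norm z)).
rewrite inE => -[Cp pc] h; exists p; split=> // y Cy.
have [yc|/ltW] := leP (l2norm (y - z)) (l2norm (c - z)).
  by apply: h; rewrite inE.
exact: le_trans.
Qed.

Lemma local_concavity_ge0 {R : realType} {d : nat} (N : 'rV[R]_d -> R)
  (C : set 'rV[R]_d) p : (0 <= local_concavity N C p)%E.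
Proof.
rewrite /local_concavity; case: ifP => _; first exact: leey.
by apply: le_ereal_inf_tmp => gam [].
Qed.

(** A finite infimum of admissible bounds is itself admissible: some admissible bound lies below
    [G + e'] for each [e' > 0], and [e'] tends to 0. *)
Lemma local_concavity_ineq {R : realType} {d : nat} (N : 'rV[R]_d -> R)
    (C : set 'rV[R]_d) (G : R) p y z :
  is_norm N -> local_concavity N C p = G%:E -> is_proj C z p -> C y ->
  dotp (y - p) (z - p) <= G * dual_norm N (z - p) * l2norm (y - p) ^+ 2.
Proof.
move=> Nn + zp Cy; rewrite /local_concavity; case: ifP => // _ GE.
set a := dual_norm N _; set b := _ ^+ 2.
have a0 : 0 <= a := dual_norm_ge0 _ Nn _.
have b0 : 0 <= b by rewrite sqr_ge0.
(* This makes [e' * (a * b) <= e]; the [+ 1] covers [a * b = 0]. *)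
apply/ler_addgt0Pr => e e0; pose e' := e / (a * b + 1).
have ab1 : 0 < a * b + 1 by rewrite ltr_wpDl// mulr_ge0.
have e'0 : 0 < e' by rewrite divr_gt0.
have /ereal_inf_lt[gam [gam0 hgam]] :
    (ereal_inf (concavity_bound N C p) < (G + e')%:E)%E.
  by rewrite GE lte_fin ltrDl.
case: gam gam0 hgam => [gam| |]//; rewrite !lee_fin lte_fin => gam0 hgam gamG.
have := hgam y z Cy zp; rewrite -!EFinM lee_fin -/a -/b => /le_trans; apply.
apply: (@le_trans _ _ ((G + e') * a * b)).
  by rewrite -!mulrA ler_wpM2r ?mulr_ge0 ?l2norm_ge0// ltW.
have -> : (G + e') * a * b = G * a * b + e' * (a * b) by ring.
rewrite lerD2l /e' mulrAC ler_pdivrMr// ler_wpM2l ?ltW//.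
by rewrite ltrDl.
Qed.

Section Proj.
Context {R : realType} {d : nat} (C : set 'rV[R]_d).
Implicit Types (p q z u y : 'rV[R]_d).

Lemma is_proj_ineq z p y :
  is_proj C z p -> C y -> l2norm (y - p) ^+ 2 >= 2 * dotp (y - p) (z - p).
Proof.
move=> [_ pmin] /pmin; rewrite -ler_sqr ?nnegrE ?l2norm_ge0//.
rewrite !l2norm_sqr !dotpE (dotpC p y) (dotpC z y) (dotpC z p); lra.
Qed.

Lemma is_proj_mem u p : C u -> is_proj C u p -> p = u.
Proof.
move=> Cu /is_proj_ineq/(_ Cu); rewrite l2norm_sqr => h.
by apply/esym/subr0_eq/dotp_eq0/le_anti; rewrite dotp_ge0 andbT; lra.
Qed.

(** Adding the first hypothesis to [is_proj_ineq] at [p'], tested with [p], bounds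
    [(1 - 2 * kappa) * l2norm (p' - p) ^+ 2] by [2 * dotp (p' - p) (z' - z)]. Only [p] needs a
    concavity bound, so [p'] may still be outside the ball. *)
Lemma is_proj_lipschitz z z' p p' kappa :
  dotp (p' - p) (z - p) <= kappa * l2norm (p' - p) ^+ 2 -> C p ->
  is_proj C z' p' ->
  (1 - 2 * kappa) * l2norm (p' - p) <= 2 * l2norm (z' - z).
Proof.
move=> hk Cp /is_proj_ineq/(_ Cp) h.
have [->|n0] := eqVneq (l2norm (p' - p)) 0.
  by rewrite mulr0 mulr_ge0 ?l2norm_ge0.
have n0' : 0 < l2norm (p' - p) by rewrite lt_def n0 l2norm_ge0.
rewrite -(ler_pM2r n0').
have := dotp_le_l2norm (p' - p) (z' - z).
move: h hk; rewrite -[p - p']opprB l2normN.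
have -> : z' - p' = (z' - z) + (z - p) - (p' - p).
  by apply/rowP => i; rewrite !mxE; ring.
move: (p' - p) (z' - z) (z - p) => a b c.
rewrite !l2norm_sqr !dotpE -!l2norm_sqr.
nra.
Qed.
End Proj.

(** As [u] lies in [C], the least dual distance from [u - s *: v] to [C] is at most [s] times the
    dual norm of [v]. Compatibility transfers this to [p] at the price of [phi], which the
    initialization bound absorbs. *)
Lemma pgd_step_normal_ineq {R : realType} {d : nat} (C : set 'rV[R]_d)
    (N : 'rV[R]_d -> R) (phi k s : R) (u v p y : 'rV[R]_d) :
  is_norm N -> 0 < phi ->
  (forall z q, is_proj C z q ->
     dual_norm N (z - q) <= phi * inf [set dual_norm N (z - w) | w in C]) ->
  ((2 * phi)%:E * local_concavity N C p * (dual_norm N v)%:E <= k%:E)%E ->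
  C u -> C y -> 0 <= s -> is_proj C (u - s *: v) p ->
  dotp (y - p) (u - s *: v - p) <= s * (k / 2) * l2norm (y - p) ^+ 2.
Proof.
move=> Nn phi0 compat hk Cu Cy s0 pp.
(* For [v = 0] the convention [0 * +oo = 0] leaves the coefficient at [p] unconstrained, but then
   [p = u]. *)
have [v0|v0] := eqVneq v 0.
  have k0 : 0 <= k.
    rewrite -lee_fin; apply: le_trans hk.
    rewrite !mule_ge0 ?local_concavity_ge0 ?lee_fin ?(dual_norm_ge0 _ Nn)//.
    by rewrite mulr_ge0// ltW.
  move: pp; rewrite v0 scaler0 subr0 => /(is_proj_mem _ _ _ Cu) ->.
  by rewrite subrr dotp0r mulr_ge0 ?sqr_ge0// mulr_ge0// divr_ge0.
have D0 := dual_norm_gt0 _ Nn _ v0.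
set D := dual_norm N v in hk D0.
have := local_concavity_ge0 N C p.
case lc : (local_concavity N C p) hk => [G| |]//; last first.
  (* An infinite coefficient, in particular at a degenerate [p], contradicts the finite bound
     because the dual norm of [v] is positive. *)
  by rewrite gt0_muley ?lte_fin ?mulr_gt0// gt0_mulye ?lte_fin.
rewrite -!EFinM !lee_fin => hk G0.
apply: le_trans (local_concavity_ineq _ _ _ _ _ _ Nn lc pp Cy) _.
rewrite ler_wpM2r ?sqr_ge0//.
have : dual_norm N (u - s *: v - p) <= phi * (s * D).
  apply: le_trans (compat _ _ pp) _; rewrite ler_pM2l//.
  apply: (@le_trans _ _ (dual_norm N (u - s *: v - u))).
    apply: ge_inf; last by exists u.
    by exists 0 => _ [w _ <-]; exact: dual_norm_ge0.
  by rewrite addrAC subrr add0r; exact: dual_normZN.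
move=> /(ler_wpM2l G0)/le_trans; apply.
have -> : G * (phi * (s * D)) = s * ((2 * phi * G * D) / 2) by field.
by rewrite ler_wpM2l// ler_pM2r.
Qed.

(** * Differentiability and the first-order condition at a minimiser *)

Section FirstOrder.
Context {R : realType} {d : nat}.
Implicit Types (x h u y v : 'rV[R]_d) (g : 'rV[R]_d -> R).

Lemma diff_dotp_grad g x h : differentiable g x -> 'd g x h = dotp h (grad g x).
Proof.
move=> dg; rewrite {1}[h]row_sum_delta linear_sum /dotp.
by apply: eq_bigr => i _; rewrite linearZ /= mxE deriveE.
Qed.

Lemma grad_expansion g x (e : R) : differentiable g x -> 0 < e ->
  exists2 delta, 0 < delta & forall h, l2norm h < delta ->
    `|g (x + h) - g x - dotp h (grad g x)| <= e * l2norm h.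
Proof.
move=> dg e0; have /eqaddoP/(_ _ e0) := diff_locally dg.
move=> /nbhs_norm0P[delta /= delta0 H]; exists delta => // h hd.
have := H h (le_lt_trans (normr_le_l2norm h) hd).
rewrite -diff_dotp_grad// -addrA -opprD [x + h]addrC => /le_trans; apply.
by rewrite ler_pM2l// normr_le_l2norm.
Qed.

(* The projections of x - s grad g(x) are o(s)-close to the minimiser x, so the
   normal inequality there passes to the limit s -> 0. *)
Lemma argmin_first_order (C : set 'rV[R]_d) g x (kappa rho : R) :
  closed C -> is_argmin C g x -> differentiable g x -> 0 <= kappa -> 0 < rho ->
  (forall s p y, 0 <= s -> is_proj C (x - s *: grad g x) p -> C y ->
     l2norm (p - x) <= rho ->
     dotp (y - p) (x - s *: grad g x - p) <= s * kappa * l2norm (y - p) ^+ 2) ->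
  forall y, C y -> - dotp (y - x) (grad g x) <= kappa * l2norm (y - x) ^+ 2.
Proof.
move=> Ccl [Cx xmin] dg k0 r0 Hn y Cy.
have [w wE] : exists w, y - x = w by exists (y - x).
rewrite wE; move: (grad g x) (grad_expansion g x ^~ dg) Hn => v expand Hn.
pose W := l2norm w; pose V := l2norm v.
have W0 : 0 <= W := l2norm_ge0 _.
have V0 : 0 <= V := l2norm_ge0 _.
apply/ler_addgt0Pr => e0 e0_gt0.
(* [e * K] bounds all error terms of the normal inequality after division by [s], given
   [l2norm h <= 2 * s * e] and [s, e <= 1]. *)
pose K := 2 * W + 2 * V + 4 * kappa * W + 4 * kappa.
have K0 : 0 <= K by rewrite /K; nra.
have [e [e_gt0 e1 eK]] : exists e, [/\ 0 < e, e <= 1 & e * K <= e0].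
  exists (Num.min 1 (e0 / (K + 1))).
  have K1 : 0 < K + 1 by lra.
  split; first by rewrite lt_min ltr01 divr_gt0.
    by rewrite ge_min lexx.
  apply: (@le_trans _ _ (e0 / (K + 1) * K)).
    by rewrite ler_wpM2r// ge_min lexx orbT.
  by rewrite mulrAC ler_pdivrMr// ler_wpM2l ?ltW// ltrDl.
have [delta delta0 Hd] := expand _ e_gt0.
(* [2 * s * V] will bound the displacement [h]; it must stay in the range of the expansion and
   within the ball. *)
have [s [s_gt0 s1 sd sr]] :
    exists s, [/\ 0 < s, s <= 1, 2 * s * V < delta & 2 * s * V <= rho].
  pose m := Num.min delta rho; have m0 : 0 < m by rewrite lt_min delta0.
  have md : m <= delta by rewrite ge_min lexx.
  have mr : m <= rho by rewrite ge_min lexx orbT.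
  have V1 : 0 < 2 * V + 1 by lra.
  pose s := Num.min 1 (m / (2 * V + 1)).
  have s0 : 0 < s by rewrite lt_min ltr01 divr_gt0.
  have : s <= m / (2 * V + 1) by rewrite ge_min lexx orbT.
  rewrite ler_pdivlMr// => sm.
  exists s; split=> //; first by rewrite ge_min lexx.
    by nra.
  by nra.
have [p pp] := exists_proj C (x - s *: v) Ccl (ex_intro _ x Cx).
have [h hE] : exists h, p - x = h by exists (p - x).
have px : p = x + h by rewrite -hE addrC subrK.
have zE : x - s *: v - p = - (s *: v) - h.
  by rewrite px opprD addrACA subrr add0r addrC.
have h0 : 0 <= l2norm h := l2norm_ge0 _.
have hh : l2norm h ^+ 2 <= - (2 * s * dotp h v).
  have := is_proj_ineq _ _ _ _ pp Cx.
  have -> : x - p = - h by rewrite -hE opprB.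
  rewrite zE l2normN !dotpE -l2norm_sqr; lra.
have cancel c : 0 <= c -> l2norm h ^+ 2 <= c * l2norm h -> l2norm h <= c.
  have [->//|n0] := eqVneq (l2norm h) 0.
  by rewrite expr2 ler_pM2r// lt_def n0.
have hV : l2norm h <= 2 * s * V.
  apply: cancel; first by rewrite !mulr_ge0// ltW.
  have := dotp_le_l2norm (- h) v; rewrite l2normN dotpNl -/V.
  move=> /(ler_wpM2l (ltW s_gt0)); lra.
(* Minimality gives [g x <= g p], so the expansion yields [- dotp h v <= e * l2norm h]; fed into
   [hh], this improves O(s) to o(s). *)
have hse : l2norm h <= 2 * s * e.
  apply: cancel; first by rewrite !mulr_ge0// ltW.
  have := Hd h (le_lt_trans hV sd); rewrite -px.
  have := xmin _ pp.1; rewrite ler_norml => gp /andP[_ +].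
  move=> le1; have /(ler_wpM2l (ltW s_gt0)) : - dotp h v <= e * l2norm h by lra.
  lra.
have := Hn s p y (ltW s_gt0) pp Cy; rewrite hE => /(_ (le_trans hV sr)).
have -> : y - p = w - h by rewrite px -wE opprD addrA.
rewrite zE.
have := dotp_le_l2norm w h; have := dotp_le_l2norm (- w) h.
have := dotp_le_l2norm (- h) v.
rewrite !l2normN !l2norm_sqr !dotpE -!l2norm_sqr (dotpC h w) -/W -/V.
move: (l2norm h) (dotp w v) (dotp w h) (dotp h v)
  h0 hh hV hse => H wv wh hv H0 hh hV hse.
move=> hv1 wh1 wh2 main.
have WH : W * H <= W * (2 * s * e) by rewrite ler_wpM2l.
have HV : H * V <= 2 * s * e * V by rewrite ler_wpM2r.
have HH : H ^+ 2 <= (2 * s * e) ^+ 2.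
  by rewrite lerXn2r// nnegrE !mulr_ge0// ltW.
have HH' : (2 * s * e) ^+ 2 <= 4 * e.
  have : s * s <= 1 by rewrite mulr_ile1// ltW.
  move=> /(ler_wpM2r (sqr_ge0 e)); have : e * e <= e by rewrite ler_piMr// ltW.
  lra.
rewrite -(ler_pM2l s_gt0).
have k1 : kappa * - wh <= kappa * (2 * s * e * W) by rewrite ler_wpM2l//; lra.
have k2 : kappa * H ^+ 2 <= kappa * (4 * e).
  by rewrite ler_wpM2l// (le_trans HH).
have sk1 : s * (kappa * (2 * s * e * W)) <= s * (kappa * (2 * e * W)).
  rewrite ler_pM2l// ler_wpM2l// ler_wpM2r// -mulrA ler_wpM2l//.
  by rewrite ler_piMl// ltW.
have sk1' : s * (kappa * - wh) <= s * (kappa * (2 * s * e * W)).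
  by rewrite ler_pM2l.
have sk2 : s * (kappa * H ^+ 2) <= s * (kappa * (4 * e)) by rewrite ler_pM2l.
have sK : s * (e * K) <= s * e0 by rewrite ler_pM2l.
have shv : s * - hv <= s * (2 * s * e * V) by rewrite ler_pM2l//; lra.
have shv' : s * (2 * s * e * V) <= s * (2 * e * V).
  by rewrite ler_pM2l// ler_wpM2r// -mulrA ler_wpM2l// ler_piMl// ltW.
rewrite /K in sK.
have := sqr_ge0 H.
lra.
Qed.
End FirstOrder.

(** * One-step contraction and confinement to the ball *)

Section Contraction.
Context {R : realType} {d : nat}.
Implicit Types (xhat u p v : 'rV[R]_d).

(** [gu], [gp], [gx] stand for the values of [g] at [u], [p], [xhat]. They cancel when the last
    three hypotheses, scaled by [s], are added, each contributing one [eps] term; the normal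
    inequality removes [v], and [s * beta <= 1] lets the smoothness term cancel the cross term of
    [u - xhat] and [p - xhat]. *)
Lemma pgd_step_contraction (alpha beta s c0 eps gu gp gx : R) xhat u p v :
  0 <= s -> s * beta <= 1 ->
  dotp (xhat - p) (u - s *: v - p) <=
    s * ((1 - c0) * alpha / 2) * l2norm (xhat - p) ^+ 2 ->
  gp <= gu + dotp (p - u) v + beta / 2 * l2norm (u - p) ^+ 2
    + alpha / 2 * eps ^+ 2 ->
  gu + dotp (xhat - u) v + alpha / 2 * l2norm (u - xhat) ^+ 2
    - alpha / 2 * eps ^+ 2 <= gx ->
  gx + c0 * alpha / 2 * l2norm (p - xhat) ^+ 2 - alpha / 2 * eps ^+ 2 <= gp ->
  (1 - s * alpha + 2 * c0 * (s * alpha)) * l2norm (p - xhat) ^+ 2 <=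
    (1 - s * alpha) * l2norm (u - xhat) ^+ 2 + 3 * (s * alpha) * eps ^+ 2.
Proof.
move=> s0 sb.
have [a aE] : exists a, p - xhat = a by exists (p - xhat).
have [b bE] : exists b, u - xhat = b by exists (u - xhat).
have -> : xhat - p = - a by rewrite -aE opprB.
have -> : xhat - u = - b by rewrite -bE opprB.
have -> : p - u = a - b by rewrite -aE -bE opprB addrA subrK.
have -> : u - p = b - a by rewrite -aE -bE opprB addrA subrK.
have -> : u - s *: v - p = (b - a) - s *: v.
  by rewrite -aE -bE opprB addrA subrK addrAC.
rewrite aE bE l2normN => normal smooth convex opt.
have := ler_wpM2r (sqr_ge0 (l2norm (b - a))) sb.
have := ler_wpM2l s0 smooth; have := ler_wpM2l s0 convex.
have := ler_wpM2l s0 opt; move: normal.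
rewrite !l2norm_sqr !dotpE (dotpC b a); lra.
Qed.

(** The weights [1 - A] and [2 * c0 * A] sum to the left coefficient, so [D'] is at most a convex
    combination of [D] and [E]. *)
Lemma le_max_of_affine_le (A c0 D D' E M : R) :
  0 < A -> A <= 1 -> 0 < c0 -> D <= M -> E <= M ->
  (1 - A + 2 * c0 * A) * D' <= (1 - A) * D + 2 * c0 * A * E -> D' <= M.
Proof.
move=> A_gt0 A1 c0_gt0 DM EM h.
have cA : 0 < c0 * A by rewrite mulr_gt0.
rewrite -(@ler_pM2l _ (1 - A + 2 * c0 * A)); last lra.
apply: le_trans h _.
have : (1 - A) * D <= (1 - A) * M by rewrite ler_wpM2l// subr_ge0.
have : c0 * A * E <= c0 * A * M by rewrite ler_pM2l.
lra.
Qed.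

(* The projection is followed along the segment from u to u - eta v: its
   Lipschitz dependence on the step keeps it inside the ball from one short
   substep to the next. *)
Lemma pgd_step_in_ball (C : set 'rV[R]_d) xhat u v p (rho alpha eta c0 M : R) :
  closed C -> C u -> 0 < alpha -> 0 < eta -> eta * alpha <= 1 ->
  0 < c0 -> c0 <= 1 -> 0 < rho -> M < rho ^+ 2 ->
  (forall s q y, 0 <= s -> is_proj C (u - s *: v) q -> C y ->
     l2norm (q - xhat) <= rho ->
     dotp (y - q) (u - s *: v - q) <=
       s * ((1 - c0) * alpha / 2) * l2norm (y - q) ^+ 2) ->
  (forall s q, 0 <= s -> s <= eta -> is_proj C (u - s *: v) q ->
     l2norm (q - xhat) <= rho -> l2norm (q - xhat) ^+ 2 <= M) ->
  l2norm (u - xhat) ^+ 2 <= M ->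
  is_proj C (u - eta *: v) p -> l2norm (p - xhat) <= rho.
Proof.
move=> Ccl Cu a0 eta0 etaa c0_gt0 c01 r0 Mr normal stay uM pp.
have M0 : 0 <= M := le_trans (sqr_ge0 _) uM.
have r0' : 0 <= rho by rewrite ltW.
(* By [stay], a projection in the ball is at distance at least [delta] from its boundary. *)
pose delta := rho - Num.sqrt M.
have delta0 : 0 < delta.
  by rewrite subr_gt0 -ltr_sqr ?nnegrE ?sqrtr_ge0// sqr_sqrtr.
have le_rho q : l2norm (q - xhat) ^+ 2 <= M -> l2norm (q - xhat) <= Num.sqrt M.
  move=> qM; rewrite -(ger0_norm (l2norm_ge0 (q - xhat))) -sqrtr_sqr.
  exact: ler_wsqrtr.
(* Enough substeps for the Lipschitz bound, with constant [2 / c0], to move a projection by at most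
   [delta]. *)
pose n := (Num.Def.archi_bound (2 * (eta * l2norm v) / (c0 * delta))).+1.
have n0 : 0 < n%:R :> R by rewrite ltr0n.
have hn : 2 * (eta / n%:R * l2norm v) <= c0 * delta.
  have cd : 0 < c0 * delta by rewrite mulr_gt0.
  have : 2 * (eta * l2norm v) / (c0 * delta) < n%:R.
    apply: lt_trans (archi_boundP _) _; last by rewrite ltr_nat.
    by rewrite divr_ge0 ?mulr_ge0 ?l2norm_ge0// ltW.
  rewrite ltr_pdivrMr// => h.
  have -> : 2 * (eta / n%:R * l2norm v) = 2 * (eta * l2norm v) / n%:R by ring.
  by rewrite ler_pdivrMr//; lra.
suff H k q : (k <= n)%N -> is_proj C (u - (k%:R * (eta / n%:R)) *: v) q ->
    l2norm (q - xhat) <= rho.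
  apply: (H n) => //; rewrite mulrCA divff ?mulr1//.
  by rewrite gt_eqF.
have en0 : 0 <= eta / n%:R by rewrite divr_ge0// ltW.
elim: k q => [|k IH] q kn qp.
  move: qp; rewrite mul0r scale0r subr0 => /(is_proj_mem _ _ _ Cu) ->.
  by apply: le_trans (le_rho _ uM) _; rewrite /delta in delta0; lra.
have [q' q'p] := exists_proj C (u - (k%:R * (eta / n%:R)) *: v) Ccl
  (ex_intro _ u Cu).
have q'r := IH q' (ltnW kn) q'p.
set s := k%:R * (eta / n%:R) in q'p.
have s0 : 0 <= s by rewrite mulr_ge0.
have se : s <= eta.
  rewrite /s mulrCA ler_piMr//; first exact: ltW.
  by rewrite ler_pdivrMr// mul1r ler_nat ltnW.
have q'M := stay s q' s0 se q'p q'r.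
have := is_proj_lipschitz _ _ _ _ _ _ (normal s q' q s0 q'p qp.1 q'r) q'p.1 qp.
have -> : u - (k.+1%:R * (eta / n%:R)) *: v - (u - s *: v) =
    - ((eta / n%:R) *: v).
  rewrite -natr1 mulrDl mul1r scalerDl -/s.
  by apply/rowP => i; rewrite !mxE; ring.
rewrite l2normN l2normZ// => lip.
(* Since [s * alpha <= 1], the Lipschitz factor is bounded below uniformly in [s]. *)
have kc : c0 <= 1 - 2 * (s * ((1 - c0) * alpha / 2)).
  have sa : s * alpha <= 1 by apply: le_trans etaa; rewrite ler_pM2r.
  have : (1 - c0) * (s * alpha) <= (1 - c0) by rewrite ler_piMr// subr_ge0.
  lra.
have : l2norm (q - q') <= delta.
  rewrite -(ler_pM2l c0_gt0); apply: le_trans hn; apply: le_trans lip.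
  by rewrite ler_wpM2r ?l2norm_ge0.
have := l2normD (q - q') (q' - xhat); have := le_rho _ q'M.
by rewrite addrA subrK /delta; lra.
Qed.
End Contraction.

(** * Linear convergence of the iterates *)

Theorem theorem3 (R : realType) (d : nat) (C : set 'rV[R]_d)
    (N : 'rV[R]_d -> R) (g : 'rV[R]_d -> R) (xhat : 'rV[R]_d)
    (rho alpha beta eps_g phi c0 : R) (x : nat -> 'rV[R]_d)
    (C_closed : closed C) (C_nonempty : C !=set0)
    (N_norm : is_norm N)
    (g_diff : forall u : 'rV[R]_d, differentiable g u)
    (xhat_min : is_argmin C g xhat)
    (rho_gt0 : 0 < rho) (alpha_gt0 : 0 < alpha) (alpha_le_beta : alpha <= beta)
    (eps_g_ge0 : 0 <= eps_g) (phi_ge1 : 1 <= phi) (c0_gt0 : 0 < c0)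
    (norm_compat : forall z p : 'rV[R]_d, is_proj C z p ->
       dual_norm N (z - p) <= phi * inf [set dual_norm N (z - u) | u in C])
    (restricted_strong_convexity : forall u v : 'rV[R]_d,
       (C `&` l2ball xhat rho) u -> (C `&` l2ball xhat rho) v ->
       g u + dotp (v - u) (grad g u) + alpha / 2 * l2norm (u - v) ^+ 2
         - alpha / 2 * eps_g ^+ 2 <= g v)
    (restricted_smoothness : forall u v : 'rV[R]_d,
       (C `&` l2ball xhat rho) u -> (C `&` l2ball xhat rho) v ->
       g v <= g u + dotp (v - u) (grad g u) + beta / 2 * l2norm (u - v) ^+ 2
         + alpha / 2 * eps_g ^+ 2)
    (initialization : forall u u' : 'rV[R]_d,
       (C `&` l2ball xhat rho) u -> (C `&` l2ball xhat rho) u' ->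
       ((2 * phi)%:E * local_concavity N C u * (dual_norm N (grad g u'))%:E
          <= ((1 - c0) * alpha)%:E)%E)
    (x0_in_C : C (x 0%N))
    (x0_close : l2norm (x 0%N - xhat) ^+ 2 < rho ^+ 2)
    (eps_g_small : eps_g ^+ 2 < c0 * rho ^+ 2 / (3 / 2))
    (x_pgd : pgd_iterates C g beta^-1 x) (t : nat) :
  l2norm (x t - xhat) ^+ 2 <=
    (1 - c0 * (2 * alpha / (alpha + beta))) ^+ t * l2norm (x 0%N - xhat) ^+ 2
      + 3 / 2 * eps_g ^+ 2 / c0.
Proof.
have r0 : 0 <= rho by rewrite ltW.
have [Chat ghat] := xhat_min.
have ballE u : (l2ball xhat rho u) = (l2norm (u - xhat) <= rho) by [].
have xhatB : (C `&` l2ball xhat rho) xhat.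
  by split=> //; rewrite ballE subrr (is_norm0 _ is_norm_l2norm).
(* The initialization condition at [xhat] has a nonnegative left side, which forces [c0 <= 1]. *)
have k0 : 0 <= (1 - c0) * alpha.
  rewrite -lee_fin; apply: le_trans (initialization _ _ xhatB xhatB).
  rewrite !mule_ge0 ?local_concavity_ge0 ?lee_fin ?(dual_norm_ge0 _ N_norm)//.
  by rewrite mulr_ge0// (le_trans ler01).
have c01 : c0 <= 1 by move: k0; rewrite pmulr_lge0// subr_ge0.
have phi0 : 0 < phi := lt_le_trans ltr01 phi_ge1.
have beta0 : 0 < beta := lt_le_trans alpha_gt0 alpha_le_beta.
have normal u s q y : C u -> l2norm (u - xhat) <= rho -> 0 <= s ->
    is_proj C (u - s *: grad g u) q -> C y -> l2norm (q - xhat) <= rho ->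
    dotp (y - q) (u - s *: grad g u - q) <=
      s * ((1 - c0) * alpha / 2) * l2norm (y - q) ^+ 2.
  move=> Cu ur s0 qp Cy qr.
  apply: (pgd_step_normal_ineq _ _ _ _ _ _ _ _ _
    N_norm phi0 norm_compat _ Cu Cy s0 qp).
  by apply: initialization; split=> //; exact: qp.1.
(* Strong convexity at [xhat]: the linear term costs at most a fraction [1 - c0] of the quadratic
   one, leaving [c0]. *)
have opt q : C q -> l2norm (q - xhat) <= rho ->
    g xhat + c0 * alpha / 2 * l2norm (q - xhat) ^+ 2 - alpha / 2 * eps_g ^+ 2
      <= g q.
  move=> Cq qr.
  have := argmin_first_order _ _ _ ((1 - c0) * alpha / 2) _ C_closed xhat_min
    (g_diff xhat) (divr_ge0 k0 (ler0n _ 2)) rho_gt0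
    (fun s p y s0 pp Cy => normal _ s p y Chat xhatB.2 s0 pp Cy) q Cq.
  have := restricted_strong_convexity xhat q xhatB (conj Cq qr).
  rewrite -[xhat - q]opprB l2normN; lra.
(* [E] is the fixed point of the affine recursion in [contraction]; the bound on [eps_g] puts it
   below [rho ^+ 2]. *)
pose E := 3 / 2 * eps_g ^+ 2 / c0.
have Er : E < rho ^+ 2 by rewrite /E ltr_pdivrMr//; lra.
have contraction u s q : C u -> l2norm (u - xhat) <= rho -> 0 <= s ->
    s <= beta^-1 -> is_proj C (u - s *: grad g u) q ->
    l2norm (q - xhat) <= rho ->
    (1 - s * alpha + 2 * c0 * (s * alpha)) * l2norm (q - xhat) ^+ 2 <=
      (1 - s * alpha) * l2norm (u - xhat) ^+ 2 + 2 * c0 * (s * alpha) * E.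
  move=> Cu ur s0 sb qp qr; have Cq := qp.1.
  have -> : 2 * c0 * (s * alpha) * E = 3 * (s * alpha) * eps_g ^+ 2.
    by rewrite /E; field; rewrite gt_eqF.
  apply: (pgd_step_contraction _ beta _ _ _ (g u) (g q) (g xhat) _ _ _ _ s0).
  - by rewrite -ler_pdivlMr// mul1r.
  - exact: normal.
  - exact: (restricted_smoothness u q).
  - exact: (restricted_strong_convexity u xhat).
  - exact: opt.
have ba : beta^-1 * alpha <= 1 by rewrite mulrC ler_pdivrMr// mul1r.
have binv0 : 0 < beta^-1 by rewrite invr_gt0.
have A0 : 0 < beta^-1 * alpha by rewrite mulr_gt0.
have sA s : s <= beta^-1 -> s * alpha <= 1.
  by move=> sb; apply: le_trans ba; rewrite ler_pM2r.
have xC n : C (x n) by case: n => // n; exact: (x_pgd n).1.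
have le_rho u : l2norm (u - xhat) ^+ 2 < rho ^+ 2 -> l2norm (u - xhat) <= rho.
  by move=> /ltW; rewrite ler_sqr ?nnegrE ?l2norm_ge0.
have stay u s q : C u -> l2norm (u - xhat) ^+ 2 < rho ^+ 2 -> 0 <= s ->
    s <= beta^-1 -> is_proj C (u - s *: grad g u) q ->
    l2norm (q - xhat) <= rho ->
    l2norm (q - xhat) ^+ 2 <= Num.max (l2norm (u - xhat) ^+ 2) E.
  (* At [s = 0] the contraction is not strict, but the projection is [u] itself. *)
  move=> Cu ur; rewrite le_eqVlt => /predU1P[<- _|s0 sb] qp qr.
    move: qp; rewrite scale0r subr0 => /(is_proj_mem _ _ _ Cu) ->.
    by rewrite le_max lexx.
  have sa : 0 < s * alpha by rewrite mulr_gt0.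
  apply: (le_max_of_affine_le (s * alpha) c0
    (l2norm (u - xhat) ^+ 2) _ E) => //.
  - exact: sA.
  - by rewrite le_max lexx.
  - by rewrite le_max lexx orbT.
  - by apply: contraction => //; [exact: le_rho|exact: ltW].
have max_lt u : l2norm (u - xhat) ^+ 2 < rho ^+ 2 ->
    Num.max (l2norm (u - xhat) ^+ 2) E < rho ^+ 2.
  by move=> ur; rewrite gt_max ur.
have in_ball n : l2norm (x n - xhat) ^+ 2 < rho ^+ 2 ->
    l2norm (x n.+1 - xhat) <= rho.
  move=> xr; apply: (pgd_step_in_ball C _ _ _ _ _ _ _ _ _ C_closed (xC n)
    alpha_gt0 binv0 ba c0_gt0 c01 rho_gt0 (max_lt _ xr) _ _ _ (x_pgd n)).
  - by move=> s q y s0 qp Cy qr; apply: normal => //; exact: le_rho.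
  - by move=> s q; exact: stay.
  - by rewrite le_max lexx.
have xr n : l2norm (x n - xhat) ^+ 2 < rho ^+ 2.
  elim: n => // n IH; apply: le_lt_trans (max_lt _ IH).
  exact: (stay _ beta^-1 _ (xC n) IH (ltW binv0) (lexx _) (x_pgd n)
    (in_ball n IH)).
rewrite -/E; elim: t => [|t IH].
  by rewrite expr0 mul1r lerDl /E divr_ge0 ?mulr_ge0 ?sqr_ge0// ltW.
have := contraction _ _ _ (xC t) (le_rho _ (xr t)) (ltW binv0) (lexx _)
  (x_pgd t) (in_ball t (xr t)).
set A := beta^-1 * alpha in ba A0 *.
have rE : c0 * (2 * alpha / (alpha + beta)) = 2 * c0 * A / (1 + A).
  by rewrite /A; field; rewrite !gt_eqF ?addr_gt0.
have A1 : 0 < 1 + A by lra.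
have cA : 0 < c0 * A by rewrite mulr_gt0.
have cA1 : c0 * A <= A by rewrite ler_piMl// ltW.
have F0 : 0 < 1 - A + 2 * c0 * A by lra.
rewrite rE in IH *; set r := 2 * c0 * A / (1 + A) in IH *.
have r1 : 0 <= 1 - r by rewrite subr_ge0 ler_pdivrMr//; lra.
(* The exact rate [(1 - A) / (1 - A + 2 * c0 * A)] is at most [1 - r], because [c0 <= 1] gives
   [1 - A + 2 * c0 * A <= 1 + A]. *)
have rF : 1 - A <= (1 - r) * (1 - A + 2 * c0 * A).
  have rA : r * (1 + A) = 2 * c0 * A by rewrite /r mulfVK// gt_eqF.
  have rr0 : 0 <= r by rewrite /r divr_ge0// ltW//; lra.
  have : r * (1 - A + 2 * c0 * A) <= r * (1 + A) by rewrite ler_wpM2l//; lra.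
  lra.
move=> main; rewrite -(ler_pM2l F0); apply: le_trans main _.
have qX0 : 0 <= (1 - r) ^+ t * l2norm (x 0%N - xhat) ^+ 2.
  by rewrite mulr_ge0 ?sqr_ge0// exprn_ge0.
have A1' : 0 <= 1 - A by rewrite subr_ge0.
have := ler_wpM2l A1' IH; have := ler_wpM2r qX0 rF; rewrite (exprS _ t); lra.
Qed.
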